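(* For $q\in H$ with $q(x)\ge1$ on $\mathbb{R}$, associated function $k$, and a constant $c>0$, define $$\alpha(x)=\begin{cases}\exp\left(-c^{-1}\sqrt{k(x)}\right)+\sup_{t\ge x-d(x)}F(t), & x\ge0,\\ \exp\left(-c^{-1}\sqrt{k(x)}\right)+\sup_{t\le x+d(x)}F(t), & x\le 0,\end{cases}$$ $$\beta(x)=\exp\left(-c^{-1}\sqrt{k(x)}\right)+\sup_{t\in[x-d(x),x+d(x)]}F(t),\qquad x\in\mathbb{R}.$$ Then, for every $c>0$, $$L:=\sup_{q}\ \limsup_{|x|\to\infty}\frac{\alpha(x)}{\beta(x)}=\infty,$$ where the supremum is taken over all $q\in H$ with $q\ge1$ on $\mathbb{R}$ (and associated functions $k$). (That is, the asymptotic formula $\rho(x)=\frac{d(x)}2(1+\varepsilon(x))$, $|\varepsilon(x)|\le c\beta(x)$ for large $|x|$, is a refinement in the class $H$ of the asymptotic formula $\rho(x)=\frac{d(x)}2(1+\varepsilon(x))$, $|\varepsilon(x)|\le c\alpha(x)$ for large $|x|$, the word ''refinement'' meaning by definition that $L=\infty$.)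
   Context: Assumption on $q$: $q:\mathbb{R}\to\mathbb{R}$, $0\le q\in L_1^{\mathrm{loc}}(\mathbb{R})$, and $\int_{-\infty}^x q(t)\,dt>0$, $\int_x^\infty q(t)\,dt>0$ for all $x\in\mathbb{R}$ (these integrals may be $+\infty$). The function $\rho$ (used only in the explanatory sentence): $\rho=uv$, where $u,v$ are positive solutions of $y''=qy$ on $\mathbb{R}$, $u$ non-increasing, $v$ non-decreasing, $v'u-u'v=1$, $v/u\to0$ at $-\infty$ and $u/v\to0$ at $\infty$; $\rho$ is uniquely determined by $q$. The function $d$: for each $x\in\mathbb{R}$, $d(x)$ is the unique solution in $d\ge 0$ of $d\int_{x-d}^{x+d}q(t)\,dt=2$. The class $H$: $q$ (satisfying the assumption above) belongs to $H$ if there is a continuous function $k:\mathbb{R}\to\mathbb{R}$ such that: (1) $k(x)\ge 2$ for all $x$, and $k(x)\to\infty$ as $|x|\to\infty$; (2) there is a constant $c_1>0$ such that for all $x\in\mathbb{R}$, $c_1^{-1}k(x)\le k(t)\le c_1k(x)$ for $t\in[x-k(x)d(x),x+k(x)d(x)]$; (3) there is a constant $c_2>0$ such that for all $x\in\mathbb{R}$, $$k(x)d(x)\sup_{z\in[0,k(x)d(x)]}\left|\int_0^z(q(x+t)-q(x-t))\,dt\right|\le c_2.$$ For $q\in H$, $k$ denotes such a function, and $$F(x)=\sqrt{k(x)}\,d(x)\sup_{z\in[0,\sqrt{k(x)}d(x)]}\left|\int_0^z(q(x+t)-q(x-t))\,dt\right|.$$ *)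

(* Defs.v *)
From HB Require Import structures.
From mathcomp Require Import all_boot all_order all_algebra.
From mathcomp Require Import all_classical all_reals all_analysis.

Set Implicit Arguments.
Unset Strict Implicit.
Unset Printing Implicit Defensive.

Import Order.TTheory GRing.Theory Num.Theory.
Import numFieldNormedType.Exports.

Local Open Scope classical_set_scope.
Local Open Scope ring_scope.

Section Defs.
Context {R : realType}.
Implicit Types (q k : R -> R) (x c h : R).

Local Notation mu := (@lebesgue_measure R).

Definition absinfty_nbhs : set_system R :=
  filter_from setT (fun M : R => [set x | M < `|x|]).

Definition admissible q : Prop :=
  [/\ forall x, 0 <= q x,
      locally_integrable setT q,
      forall x, (0 < \int[mu]_(t in `]-oo, x]) (q t)%:E)%E
    & forall x, (0 < \int[mu]_(t in `[x, +oo[) (q t)%:E)%E].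

(* For admissible q the defining equation has exactly one solution d >= 0:
   its left-hand side is continuous in d, vanishes at 0, tends to +oo, and is
   strictly increasing where it is positive. *)
Definition dfun q x : R :=
  get [set d | 0 <= d /\ d * \int[mu]_(t in `[x - d, x + d]) q t = 2].

Definition sup_asym q x h : \bar R :=
  ereal_sup [set `| \int[mu]_(t in `[0, z]) (q (x + t) - q (x - t)) |%:E
            | z in `[0, h]].

Definition associated q k : Prop :=
  [/\ continuous k,
      (forall x, 2 <= k x) /\ k x @[x --> absinfty_nbhs] --> +oo,
      exists2 c1, 0 < c1 &
        forall x t, t \in `[x - k x * dfun q x, x + k x * dfun q x] ->
          c1^-1 * k x <= k t <= c1 * k x
    & exists2 c2, 0 < c2 &
        forall x, ((k x * dfun q x)%:E * sup_asym q x (k x * dfun q x)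
                   <= c2%:E)%E].

Definition classH q : Prop := admissible q /\ exists k, associated q k.

Definition Ffun q k x : \bar R :=
  ((Num.sqrt (k x) * dfun q x)%:E
   * sup_asym q x (Num.sqrt (k x) * dfun q x))%E.

(* At x = 0 both one-sided formulas are meant to apply; only the first one is
   used here, which does not affect the behaviour as |x| -> oo. *)
Definition alpha q k c x : \bar R :=
  ((expR (- (c^-1 * Num.sqrt (k x))))%:E
   + (if (0 <= x)%R
      then ereal_sup [set Ffun q k t | t in `[(x - dfun q x)%R, +oo[]
      else ereal_sup [set Ffun q k t | t in `]-oo, (x + dfun q x)%R]]))%E.

Definition beta q k c x : \bar R :=
  ((expR (- (c^-1 * Num.sqrt (k x))))%:E
   + ereal_sup [set Ffun q k t
               | t in `[(x - dfun q x)%R, (x + dfun q x)%R]])%E.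

Definition refinementL c : \bar R :=
  ereal_sup [set l | exists q k,
    [/\ classH q, forall x, 1 <= q x, associated q k
      & l = limf_esup (fun x => alpha q k c x / beta q k c x)%E
                      absinfty_nbhs]].

End Defs.

(* Main.v *)
(* Take q = 1 + 1/D^2, where D(x) is the largest power of 2 below x (and D = 1
   for x < 2), together with k(x) = 2 + |x|/2.  Then q decreases by a jump of
   order N^-2 at each dyadic point N, which is small enough for condition (3),
   as k d <= k.  At the middle x of the plateau [N, 2N) the window of width
   sqrt k sees no jump, so F vanishes near x and beta(x) is exactly
   exp(- sqrt k(x) / c).  But alpha(x) also sees the next jump, where F is at
   least of order 1/N, so alpha/beta is at least of order
   N^-1 exp(sqrt (3 N / 4) / c), which is unbounded. *)

Require Import Defs.
From HB Require Import structures.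
From mathcomp Require Import all_boot all_order all_algebra.
From mathcomp Require Import all_classical all_reals all_analysis.
From mathcomp Require Import measurable_realfun ring lra.
Import Order.TTheory GRing.Theory Num.Theory.
Import numFieldNormedType.Exports.

Local Open Scope classical_set_scope.
Local Open Scope ring_scope.

(** * Integrals of bounded functions over intervals *)

Section Interval_integrals.
Context {R : realType}.
Implicit Types (f : R -> R) (a b M : R).
Notation mu := (@lebesgue_measure R).

Lemma bounded_integrable_itv f M a b : measurable_fun setT f ->
  (forall x, `|f x| <= M) -> mu.-integrable `[a, b] (EFin \o f).
Proof.
move=> mf fM; have muab : (mu `[a, b] < +oo)%E.
  by rewrite lebesgue_measure_itv /=; case: ifP => // _; rewrite -EFinD ltry.
apply: measurable_bounded_integrable => //.
- exact: measurable_funS mf.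
- exists M; split; first exact: num_real.
  by move=> y My x _ /=; exact: le_trans (fM x) (ltW My).
Qed.

Lemma Rintegral_itvcc_cst M a b : a <= b ->
  \int[mu]_(t in `[a, b]) M = M * (b - a).
Proof.
move=> ab; rewrite Rintegral_cst//=; congr (_ * _).
transitivity (fine (mu `[a, b])) => //; rewrite lebesgue_measure_itv /= lte_fin.
by case: ltgtP ab => // -> _; rewrite subrr.
Qed.

Lemma integrable_itv_cst M a b : mu.-integrable `[a, b] (EFin \o cst M).
Proof. by apply: (@bounded_integrable_itv (cst M) `|M|). Qed.

Lemma Rintegral_itv_le f M a b : a <= b ->
  mu.-integrable `[a, b] (EFin \o f) ->
  (forall t, t \in `[a, b] -> f t <= M) ->
  \int[mu]_(t in `[a, b]) f t <= M * (b - a).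
Proof.
move=> ab intf fM; rewrite -Rintegral_itvcc_cst//.
by apply: le_Rintegral => //; exact: integrable_itv_cst.
Qed.

Lemma Rintegral_itv_ge f M a b : a <= b ->
  mu.-integrable `[a, b] (EFin \o f) ->
  (forall t, t \in `[a, b] -> M <= f t) ->
  M * (b - a) <= \int[mu]_(t in `[a, b]) f t.
Proof.
move=> ab intf fM; rewrite -Rintegral_itvcc_cst//.
by apply: le_Rintegral => //; exact: integrable_itv_cst.
Qed.

(** With P the primitive based at x - a, the integral is P(x + d) - P(x - d), and P is continuous
    inside the window. *)
Lemma Rintegral_sym_continuous f x a : 0 < a ->
  mu.-integrable `[x - a, x + a] (EFin \o f) ->
  {in `]0, a[, continuous (fun d => \int[mu]_(t in `[x - d, x + d]) f t)}.
Proof.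
move=> a0 intf d; rewrite in_itv/= => /andP[d0 da].
pose P y := \int[mu]_(t in `[x - a, y]) f t.
have xa : x - a < x + a by lra.
have /(continuous_within_itvP _ xa)[cP _ _] :
  {within `[x - a, x + a], continuous P}.
  by apply: parameterized_integral_continuous => //; exact: ltW.
have PE r : 0 < r < a ->
    P (x + r) - P (x - r) = \int[mu]_(t in `[x - r, x + r]) f t.
  move=> /andP[r0 ra].
  have intr : mu.-integrable `[x - a, x + r] (EFin \o f).
    apply: integrableS intf => //.
    by apply: subset_itvl; rewrite bnd_simp; lra.
  rewrite /P Rintegral_itvB//; last 2 first.
  - by rewrite bnd_simp; lra.
  - by rewrite bnd_simp; lra.
  rewrite Rintegral_itv_obnd_cbnd//; apply: integrableS intr => //.
  by apply: subset_itvr; rewrite bnd_simp; lra.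
have : {for d, continuous (fun r => P (x + r) - P (x - r))}.
  apply: cvgB.
    apply: (@continuous_comp _ _ _ (fun r => x + r) P).
      by apply: cvgD; [exact: cvg_cst|exact: cvg_id].
    by apply: cP; rewrite in_itv/=; lra.
  apply: (@continuous_comp _ _ _ (fun r => x - r) P).
    by apply: cvgB; [exact: cvg_cst|exact: cvg_id].
  by apply: cP; rewrite in_itv/=; lra.
rewrite /prop_for /continuous_at PE ?d0//; apply: cvg_trans.
apply: near_eq_cvg; near=> r; apply/PE/andP; split; near: r.
- exact: lt_nbhsr.
- exact: lt_nbhsl.
Unshelve. all: by end_near. Qed.

End Interval_integrals.

(** * Potentials with values between 1 and 2 *)

Section Potential_between_1_and_2.
Context {R : realType} (q : R -> R) (mq : measurable_fun setT q).
Context (q1 : forall x, 1 <= q x) (q2 : forall x, q x <= 2).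
Notation mu := (@lebesgue_measure R).

Lemma integrable_itv_between a b : mu.-integrable `[a, b] (EFin \o q).
Proof.
by apply: (@bounded_integrable_itv _ q 2) => // x; rewrite ger0_norm ?q2//;
   exact: le_trans (q1 x).
Qed.

Lemma Rintegral_sym_between x d : 0 <= d ->
  2 * d <= \int[mu]_(t in `[x - d, x + d]) q t <= 4 * d.
Proof.
move=> d0; have xd : x - d <= x + d by lra.
have := Rintegral_itv_le _ _ _ _ xd (integrable_itv_between _ _) (fun t _ => q2 t).
have := Rintegral_itv_ge _ _ _ _ xd (integrable_itv_between _ _) (fun t _ => q1 t).
lra.
Qed.

(** [dfun] is a [get], so its equation can be used only once a solution is known. The left-hand side
    lies between 2 d^2 and 4 d^2: it is at most 1 at d = 1/2 and at least 2 at d = 1. *)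
Lemma dfun_exists x :
  exists d, 0 <= d /\ d * \int[mu]_(t in `[x - d, x + d]) q t = 2.
Proof.
pose f d := d * \int[mu]_(t in `[x - d, x + d]) q t.
have f12 : (1 / 2 : R) <= 1 by lra.
have [||d] := @IVT _ f _ _ 2 f12.
- apply: continuous_in_subspaceT => d; rewrite inE/= in_itv/= => /andP[d1 d2].
  apply: cvgM; first exact: cvg_id.
  (* Radius 2 makes the open interval of continuity contain all of [1/2, 1]. *)
  apply: (@Rintegral_sym_continuous _ q x 2) => //.
    exact: integrable_itv_between.
  by rewrite in_itv/=; lra.
- have h0 : (0 : R) <= 1 / 2 by lra.
  have := Rintegral_sym_between x _ h0.
  have := Rintegral_sym_between x _ ler01.
  rewrite /f ge_min le_max => /andP[A B] /andP[C D].
  by apply/andP; split; apply/orP; [left|right]; lra.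
by rewrite in_itv/= => /andP[d1 d2] fd; exists d; split => //; lra.
Qed.

(** The defining equation gives 2 d^2 <= 2 <= 4 d^2. *)
Lemma dfun_bounds x : [/\ 0 <= dfun q x, dfun q x <= 1 & 1 / 2 <= dfun q x ^+ 2].
Proof.
have [] := getPex (dfun_exists x); rewrite -/(dfun q x).
move: (dfun q x) => d d0 dE; have /andP[] := Rintegral_sym_between x _ d0.
move: (Rintegral _ _ _) dE => I dE dI Id; rewrite expr2; split => //; last nra.
by rewrite leNgt; apply/negP => d1; nra.
Qed.

Lemma integrable_asym x a b :
  mu.-integrable `[a, b] (EFin \o (fun t => q (x + t) - q (x - t))).
Proof.
apply: (@bounded_integrable_itv _ _ 1).
  by apply: measurable_funB; apply: measurableT_comp => //;
    [exact: measurable_funD|exact: measurable_funB].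
move=> t; rewrite ler_norml.
have := q1 (x + t); have := q1 (x - t).
by have := q2 (x + t); have := q2 (x - t); lra.
Qed.

Lemma sup_asym_le x h e : 0 <= h -> 0 <= e ->
  (forall t, t \in `[0, h] -> `|q (x + t) - q (x - t)| <= e) ->
  (sup_asym q x h <= (h * e)%:E)%E.
Proof.
move=> h0 e0 qe; apply: ge_ereal_sup => _ [z /= + <-].
rewrite in_itv/= => /andP[z0 zh]; rewrite lee_fin.
have qez t : t \in `[0, z] -> - e <= q (x + t) - q (x - t) <= e.
  rewrite in_itv/= => /andP[t0 tz]; rewrite -ler_norml; apply: qe.
  by rewrite in_itv/= t0 (le_trans tz).
have := Rintegral_itv_le _ e _ _ z0 (integrable_asym x _ _)
  (fun t tz => proj2 (andP (qez t tz))).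
have := Rintegral_itv_ge _ _ _ _ z0 (integrable_asym x _ _)
  (fun t tz => proj1 (andP (qez t tz))).
move: (Rintegral _ _ _) => I; rewrite !subr0 => le_I I_le.
have ez : e * z <= h * e by nra.
by rewrite ler_norml; lra.
Qed.

Lemma sup_asym_ge0 x h : 0 <= h -> (0 <= sup_asym q x h)%E.
Proof.
(* An empty supremum would be -oo; z = 0 contributes the value 0. *)
move=> h0; apply: le_ereal_sup_tmp; eexists.
  by exists 0 => //=; rewrite in_itv/= lexx.
by rewrite lee_fin.
Qed.

Lemma sup_asym_eq0 x h : 0 <= h ->
  (forall t, t \in `[0, h] -> q (x + t) = q (x - t)) -> sup_asym q x h = 0%E.
Proof.
move=> h0 qe; apply/eqP; rewrite eq_le sup_asym_ge0// andbT.
have := @sup_asym_le x h 0; rewrite mulr0; apply => // t /qe ->.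
by rewrite subrr normr0.
Qed.

(** The choice z = h suffices. The bound is asked on ]0, h] only: at t = 0 the difference is 0, so
    it would fail there for e > 0. *)
Lemma sup_asym_ge x h e : 0 <= h ->
  (forall t, t \in `]0, h] -> q (x + t) - q (x - t) <= - e) ->
  ((h * e)%:E <= sup_asym q x h)%E.
Proof.
move=> h0 qe; apply: le_ereal_sup_tmp; eexists.
  by exists h => //=; rewrite in_itv/= h0 lexx.
rewrite lee_fin -normrN ler_normr lerNr -mulrN; apply/orP; left.
have int0h : mu.-integrable `]0, h] (EFin \o (fun t => q (x + t) - q (x - t))).
  apply: integrableS (integrable_asym x 0 h) => //.
  by apply: subset_itvr; rewrite bnd_simp.
have intc : mu.-integrable `]0, h] (EFin \o cst (- e)).
  apply: integrableS (integrable_itv_cst (- e) 0 h) => //.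
  by apply: subset_itvr; rewrite bnd_simp.
rewrite [leRHS](_ : _ = \int[mu]_(t in `[0, h]) - e); last first.
  by rewrite Rintegral_itvcc_cst// subr0 mulrC.
by rewrite -!Rintegral_itv_obnd_cbnd//; exact: le_Rintegral.
Qed.

(** q >= 1 bounds the half-line integrals below by an infinite measure; q <= 2 bounds the integral
    over a compact set by twice its measure. *)
Lemma between_admissible : admissible q.
Proof.
have q0 x : 0 <= q x by exact: le_trans (q1 x).
have ge_mu (D : set R) : measurable D ->
    (mu D <= \int[mu]_(t in D) (q t)%:E)%E.
  move=> mD; rewrite -[leLHS]mul1e -integral_cst//; apply: ge0_le_integral => //.
  - by apply/measurable_EFinP; exact: measurable_funS mq.
  - by move=> x _; rewrite lee_fin.
split => //.
- split => //; first exact: openT.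
  move=> K _ cK; have mK := compact_measurable cK.
  apply: (@le_lt_trans _ _ (\int[mu]_(x in K) cst 2%:E x)%E).
    apply: ge0_le_integral => //=.
    - apply/measurable_EFinP; apply: measurableT_comp => //.
      exact: measurable_funS mq.
    - by move=> x _; rewrite lee_fin ger0_norm.
  rewrite integral_cst//.
  by apply: lte_mul_pinfty; rewrite ?lee_fin//; exact: compact_finite_measure.
- move=> x; apply: lt_le_trans (ge_mu _ _) => //.
  by rewrite lebesgue_measure_itv/= ltNyr/= ltry.
- move=> x; apply: lt_le_trans (ge_mu _ _) => //.
  by rewrite lebesgue_measure_itv/= ltry/= ltry.
Qed.

End Potential_between_1_and_2.

(** * The dyadic step potential, its function k, and the ratio alpha/beta *)

Section Dyadic_potential.
Context {R : realType}.
Implicit Types (x y t c : R) (n : nat).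

(** Truncation sends negative reals to 0 and [trunc_log 2 0] is 0, whence the value 1 on the whole
    half-line below 2. *)
Definition dyad x : R := (2 ^ trunc_log 2 (Num.truncn x))%:R.

Lemma dyad_ge1 x : 1 <= dyad x.
Proof. by rewrite ler1n expn_gt0. Qed.

Lemma dyad_homo : {homo dyad : x y / x <= y}.
Proof.
by move=> x y xy; rewrite ler_nat leq_exp2l//; exact/leq_trunc_log/le_truncn.
Qed.

Lemma dyad_gt x : x < 2 * dyad x.
Proof.
rewrite -natrM -expnS; set m := (2 ^ _)%N.
have m0 : (0 < m)%N by rewrite expn_gt0.
(* [truncn_le_nat] expects a successor on the real side, hence the detour through the predecessor of
   m. *)
by rewrite -(prednK m0) -truncn_le_nat -ltnS prednK// trunc_log_ltn.
Qed.

Lemma dyad_eq n x : 2 ^+ n <= x < 2 * 2 ^+ n -> dyad x = 2 ^+ n.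
Proof.
move=> /andP[nx xn]; have x0 : 0 <= x by apply: le_trans nx; exact: exprn_ge0.
rewrite /dyad -natrX; congr (_ ^ _)%:R; apply: trunc_log_eq => //.
by rewrite truncn_ge_nat// truncn_lt_nat// expnS natrM natrX nx xn.
Qed.

Lemma dyad_small x : x < 2 -> dyad x = 1.
Proof.
rewrite -truncn_le_nat /dyad => x1.
by rewrite (_ : trunc_log 2 _ = 0%N)//; apply/eqP; rewrite trunc_log_eq0.
Qed.

Definition qdy x : R := 1 + (dyad x ^+ 2)^-1.
(** With slope 1/2, k varies by at most k/2 over a window of radius k, and for x >= 0 that window
    stays to the right of x/2 - 2. *)
Definition kdy x : R := 2 + `|x| / 2.

Lemma dyadV_bounds x : 0 <= (dyad x ^+ 2)^-1 <= 1.
Proof.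
have d1 := dyad_ge1 x; rewrite invr_ge0 sqr_ge0 invf_le1.
  by rewrite exprn_ege1.
by rewrite exprn_gt0// (lt_le_trans ltr01).
Qed.

Lemma qdy_ge1 x : 1 <= qdy x.
Proof. by rewrite lerDl; case/andP: (dyadV_bounds x). Qed.

Lemma qdy_le2 x : qdy x <= 2.
Proof. by rewrite /qdy; have := dyadV_bounds x; lra. Qed.

Lemma qdy_measurable : measurable_fun setT qdy.
Proof.
apply: nonincreasing_measurable => // x y xy; rewrite lerD2l.
have d0 z : 0 < dyad z by exact: lt_le_trans (dyad_ge1 z).
rewrite lef_pV2 ?posrE ?exprn_gt0//; apply: lerXn2r; rewrite ?nnegrE ?(ltW (d0 _))//.
exact: dyad_homo.
Qed.

Lemma kdy_ge2 x : 2 <= kdy x.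
Proof. by rewrite lerDl divr_ge0. Qed.

Let dq := dfun qdy.

Lemma dq_bounds x : [/\ 0 <= dq x, dq x <= 1 & 1 / 2 <= dq x ^+ 2].
Proof. exact: dfun_bounds qdy_measurable qdy_ge1 qdy_le2 x. Qed.

Lemma kdy_lip x t : `|kdy x - kdy t| <= `|x - t| / 2.
Proof.
rewrite /kdy opprD addrACA subrr add0r -mulrBl normrM [`|2^-1|]ger0_norm//.
by rewrite ler_pM2r ?invr_gt0// ler_dist_dist.
Qed.

(** For x <= -8 the window lies below 2, where q is constant. Elsewhere [dyad] is at least k/6 at
    both points, so both values of q - 1 lie in [0, 36/k^2]. *)
Lemma qdy_asym_le x t : 0 <= t <= kdy x ->
  `|qdy (x + t) - qdy (x - t)| <= 36 / kdy x ^+ 2.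
Proof.
move=> /andP[t0 tk]; have k2 := kdy_ge2 x.
have bound y : kdy x <= 6 * dyad y -> 0 <= (dyad y ^+ 2)^-1 <= 36 / kdy x ^+ 2.
  move=> ky; have /andP[-> _]/= := dyadV_bounds y.
  have d1 := dyad_ge1 y.
  rewrite ler_pdivlMr ?exprn_gt0//; last by lra.
  by rewrite mulrC ler_pdivrMr ?exprn_gt0//; [nra|lra].
have close y1 y2 : kdy x <= 6 * dyad y1 -> kdy x <= 6 * dyad y2 ->
    `|qdy y1 - qdy y2| <= 36 / kdy x ^+ 2.
  by move=> /bound b1 /bound b2; rewrite /qdy ler_norml; lra.
have [x8|x8] := leP x (-8).
  rewrite /kdy ler0_norm in tk; last by lra.
  rewrite /qdy !dyad_small ?subrr ?normr0; [|lra..].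
  by rewrite divr_ge0// exprn_ge0//; lra.
(* By [dyad_gt], 6 [dyad] (x - t) exceeds 3 (x - k) = 3x/2 - 6, which is at least k = 2 + x/2 once x
   >= 8. In the remaining range k <= 6 and [dyad] >= 1. *)
have [x8'|x8'] := leP 8 x.
  have := dyad_gt (x + t); have := dyad_gt (x - t).
  have : kdy x = 2 + x / 2 by rewrite /kdy ger0_norm//; lra.
  by move=> kE d1 d2; apply: close; lra.
have : kdy x <= 6.
  have : `|x| <= 8 by rewrite ler_norml; lra.
  by rewrite /kdy; lra.
move=> k6; apply: close.
- by have := dyad_ge1 (x + t); lra.
- by have := dyad_ge1 (x - t); lra.
Qed.

Lemma kdy_continuous : continuous kdy.
Proof.
move=> x; apply: cvgD; first exact: cvg_cst.
by apply: cvgMl; exact: (@norm_continuous _ R^o).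
Qed.

Lemma kdy_cvgy : kdy x @[x --> absinfty_nbhs] --> +oo.
Proof.
move=> A [M [_ MA]]; exists (2 * M) => //= x /= Mx; apply: MA => /=.
by rewrite /kdy; lra.
Qed.

Lemma associated_dyadic : associated qdy kdy.
Proof.
split.
- exact: kdy_continuous.
- by split; [exact: kdy_ge2|exact: kdy_cvgy].
- exists 2 => // x t; rewrite in_itv/= -/dq => xt.
  have [d0 d1 _] := dq_bounds x; have k2 := kdy_ge2 x.
  have kd : kdy x * dq x <= kdy x by rewrite ler_piMr//; lra.
  have : `|x - t| <= kdy x by rewrite ler_norml; lra.
  by have := kdy_lip x t; rewrite ler_norml; lra.
(* The pointwise bound 36/k^2 yields (k d)^2 36/k^2 = 36 d^2 <= 36. *)
- exists 36 => // x; have [d0 d1 _] := dq_bounds x; have k2 := kdy_ge2 x.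
  have kd0 : 0 <= kdy x * dq x by rewrite mulr_ge0//; lra.
  have kd : kdy x * dq x <= kdy x by rewrite ler_piMr//; lra.
  have e0 : 0 <= 36 / kdy x ^+ 2 by rewrite divr_ge0// sqr_ge0.
  apply: (@le_trans _ _ ((kdy x * dq x) * (kdy x * dq x * (36 / kdy x ^+ 2)))%:E).
    rewrite [leRHS]EFinM; apply: lee_wpmul2l; rewrite ?lee_fin//.
    apply: (sup_asym_le qdy qdy_measurable qdy_ge1 qdy_le2) => // t.
    rewrite in_itv/= => /andP[t0 tkd]; apply: qdy_asym_le.
    by rewrite t0 (le_trans tkd).
  rewrite lee_fin (_ : _ * _ = 36 * dq x ^+ 2); last by field; lra.
  by rewrite expr2; nra.
Qed.

(** With N = 2^n, a window of radius at most N/2 - 2 around t stays in [N + 1, 2N - 1], inside one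
    plateau. The margin 1 around 3N/2 covers the range of beta, as d <= 1. *)
Lemma Ffun_dyadic_eq0 n t : 16 <= 2 ^+ n :> R ->
  3 / 2 * 2 ^+ n - 1 <= t <= 3 / 2 * 2 ^+ n + 1 -> Ffun qdy kdy t = 0%E.
Proof.
move: (erefl (2 ^+ n : R)); set N := RHS => NE N16 tN.
have [d0 d1 _] := dq_bounds t.
have s0 := sqrtr_ge0 (kdy t).
(* Here k <= 3N/4 + 5/2, which is below (N/2 - 2)^2 for N >= 16. *)
have sN : Num.sqrt (kdy t) <= N / 2 - 2.
  rewrite -[leRHS]ger0_norm -?sqrtr_sqr; last by lra.
  rewrite ler_wsqrtr// /kdy ger0_norm; last by lra.
  by rewrite expr2; nra.
have sd : Num.sqrt (kdy t) * dq t <= Num.sqrt (kdy t) by rewrite ler_piMr.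
rewrite /Ffun -/dq (@sup_asym_eq0 _ qdy qdy_measurable qdy_ge1 qdy_le2) ?mule0//.
  by rewrite mulr_ge0.
move=> s; rewrite in_itv/= => /andP[s_ge0 ssd].
by rewrite /qdy !(@dyad_eq n)// NE; lra.
Qed.

(** The window is centred at the jump 2N and its radius z = sqrt(k) d is below N, so it meets only
    the two adjacent plateaus, where q differs by 1/N^2 - 1/(4N^2). Finally z^2 = (2 + N) d^2 >=
    N/2. *)
Lemma Ffun_dyadic_ge n : 16 <= 2 ^+ n :> R ->
  ((3 / (8 * 2 ^+ n))%:E <= Ffun qdy kdy (2 ^+ n.+1))%E.
Proof.
rewrite exprS; move: (erefl (2 ^+ n : R)); set N := RHS => NE N16.
have [d0 d1 d2] := dq_bounds (2 * N).
have kE : kdy (2 * N) = 2 + N by rewrite /kdy ger0_norm; [lra|lra].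
have s0 := sqrtr_ge0 (kdy (2 * N)).
have sE : Num.sqrt (kdy (2 * N)) ^+ 2 = 2 + N by rewrite sqr_sqrtr kE//; lra.
have sN : Num.sqrt (kdy (2 * N)) < N by rewrite expr2 in sE; nra.
rewrite /Ffun -/dq.
have zN : Num.sqrt (kdy (2 * N)) * dq (2 * N) <= Num.sqrt (kdy (2 * N)).
  by rewrite ler_piMr.
have z0 : 0 <= Num.sqrt (kdy (2 * N)) * dq (2 * N) by rewrite mulr_ge0.
have zE : (Num.sqrt (kdy (2 * N)) * dq (2 * N)) ^+ 2 = (2 + N) * dq (2 * N) ^+ 2.
  by rewrite exprMn sE.
move: (Num.sqrt _ * _) z0 zN zE => z z0 zN zE.
apply: (@le_trans _ _ (z * (z * (3 / (4 * N ^+ 2))))%:E); last first.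
  rewrite [leLHS]EFinM; apply: lee_wpmul2l; rewrite ?lee_fin//.
  apply: (sup_asym_ge qdy qdy_measurable qdy_ge1 qdy_le2) => // t.
  rewrite in_itv/= => /andP[t0 tz].
  (* Strict positivity of t puts 2N - t on the plateau before the jump. *)
  rewrite /qdy (@dyad_eq n.+1 (_ + _)) ?(@dyad_eq n (_ - _)) ?exprS ?NE; [|lra..].
  by rewrite le_eqVlt; apply/orP; left; apply/eqP; field; lra.
have -> : 3 / (8 * N) = N * (1 / 2) * (3 / (4 * N ^+ 2)) by field; lra.
rewrite lee_fin mulrA -expr2 zE.
rewrite ler_wpM2r//; first by rewrite divr_ge0// mulr_ge0// sqr_ge0.
by nra.
Qed.

Lemma alpha_beta_dyadic_ge c n : 0 < c -> 16 <= 2 ^+ n :> R ->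
  ((2 ^+ n / (256 * c ^+ 4))%:E <= alpha qdy kdy c (3 / 2 * 2 ^+ n)
                                 / beta qdy kdy c (3 / 2 * 2 ^+ n))%E.
Proof.
move=> c0 N16; have := Ffun_dyadic_ge n N16; have := @Ffun_dyadic_eq0 n _ N16.
rewrite exprS; move: (2 ^+ n : R) N16 => N N16 F0 FN.
move: (erefl (3 / 2 * N)); set x := RHS => xE.
have [d0 d1 _] := dq_bounds x.
pose e := c^-1 * Num.sqrt (kdy x).
have -> : beta qdy kdy c x = (expR (- e))%:E.
  (* F vanishes on the whole range of the supremum, and x itself shows that range to be nonempty. *)
  rewrite /beta (_ : [set _ | _ in _] = [set 0%E]) ?ereal_sup1 ?adde0//.
  rewrite -/dq; apply/seteqP; split => [_ [t /= + <-]|_ ->].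
    by rewrite in_itv/= => tx; rewrite F0//; lra.
  by exists x; rewrite ?F0 //=; rewrite ?in_itv/=; lra.
rewrite inver expR_eq0 -expRN opprK.
have x0 : 0 <= x by lra.
rewrite /alpha x0.
apply: (@le_trans _ _ ((3 / (8 * N))%:E * (expR e)%:E)%E); last first.
  apply: lee_wpmul2r; first by rewrite lee_fin expR_ge0.
  rewrite -[leLHS]add0e; apply: leeD; first by rewrite lee_fin expR_ge0.
  apply: le_ereal_sup_tmp; eexists; last exact: FN.
  by exists (2 * N) => //=; rewrite in_itv/= andbT -/dq; lra.
rewrite -EFinM lee_fin.
have kE : kdy x = 2 + x / 2 by rewrite /kdy ger0_norm.
have e0 : 0 <= e by rewrite mulr_ge0 ?sqrtr_ge0// invr_ge0 ltW.
(* The fourth-order term clears the square root and is quadratic in N, so it beats the factor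
   3/(8N). As k >= 3N/4, the product is at least 9N/(1024 c^4), which exceeds N/(256 c^4). *)
have := expR_ge1Dxn 3 e0; rewrite (_ : 4`! = 24%N)//.
have -> : e ^+ 4 = (c ^+ 4)^-1 * kdy x ^+ 2.
  have k0 : 0 <= kdy x by rewrite kE; lra.
  by rewrite exprMn exprVn -[in RHS](sqr_sqrtr k0) -exprM.
have -> : N / (256 * c ^+ 4) = N / 256 * (c ^+ 4)^-1 by rewrite invfM mulrA.
rewrite kE; have : 0 <= (c ^+ 4)^-1.
  by rewrite invr_ge0 exprn_ge0// ltW.
move: (c ^+ 4)^-1 (expR e) => w E w0 Ew; rewrite [leRHS]mulrAC ler_pdivlMr; last by lra.
by nra.
Qed.

Lemma limsup_dyadic c : 0 < c ->
  limf_esup (fun x => alpha qdy kdy c x / beta qdy kdy c x)%E absinfty_nbhs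
  = +oo%E.
Proof.
move=> c0; apply/eqP; rewrite -leye_eq.
apply: le_ereal_inf_tmp => _ [A [M _ MA] <-]; rewrite leye_eq; apply/eqP/eqyP => r r0.
(* The three entries serve the plateau estimates, membership of the midpoint in the neighbourhood A,
   and a ratio of at least r. *)
pose b := Num.max 16 (Num.max M (r * (256 * c ^+ 4))).
pose n := (Num.truncn b).+1.
have : b <= 2 ^+ n.
  rewrite -natrX (le_trans (ltW (truncnS_gt b)))// ler_nat.
  by rewrite ltnW// ltn_expl.
rewrite !ge_max => /and3P[N16 NM Nr].
apply: le_ereal_sup_tmp; eexists.
  exists (3 / 2 * 2 ^+ n) => //; apply: MA => /=.
  by rewrite ger0_norm; lra.
apply: le_trans (alpha_beta_dyadic_ge _ _ c0 N16).
by rewrite lee_fin ler_pdivlMr// mulr_gt0// exprn_gt0.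
Qed.

End Dyadic_potential.

Theorem theorem1p7 (R : realType) (c : R) (hc : 0 < c) :
  refinementL c = +oo%E.
Proof.
apply: ereal_supy; exists qdy, kdy; split.
- split; last by exists kdy; exact: associated_dyadic.
  exact: between_admissible qdy_measurable qdy_ge1 qdy_le2.
- exact: qdy_ge1.
- exact: associated_dyadic.
- by rewrite limsup_dyadic.
Qed.
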